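(* Let $G=(V,E)$ be a connected undirected graph with $n$ nodes and average degree $d_{avg}=\frac1n\sum_{v_i\in V}d_i$, let $0\le p\le 1$, and let each node independently be private with probability $p$ and public otherwise. Under the condition that all the public nodes belong to the largest public-cluster, we have $$\left|\,d_{avg}-\frac{E_{pri}[D^*]}{E_{pri}\left[\sum_{v_i\in V^*}\frac{d_i^*}{d_i}\right]}\right|\le\left|\,d_{avg}-\frac{E_{pri}[D^*]}{E_{pri}[n^*]}\right|.$$
   Context: $G=(V,E)$, $V=\{v_1,\dots,v_n\}$, is a connected undirected graph and $d_i$ is the degree of $v_i$ in $G$. $E_{pri}$ denotes expectation regarding the random set of privacy labels. The public-clusters are the connected components of the subgraph of $G$ formed by the public nodes; $C^*=(V^*,E^* )$ is the largest public-cluster and $n^*=|V^*|$. For $v_i\in V^*$, the public-degree is $d_i^*=|\{v_j\in V^*:(v_i,v_j)\in E^*\}|$, and $D^*=\sum_{v_i\in V^*}d_i^*$. Under the condition that all the public nodes belong to the largest public-cluster, one takes $\Pr[v_i\in V^*]=\Pr[v_i\text{ is public}]=1-p$; for $v_i\in V^*$, $d_i^*$ follows the binomial distribution with parameters $d_i$ and $1-p$ regarding the privacy labels. *)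

(* Defs.v *)
From mathcomp Require Import all_boot all_order all_algebra.

Set Implicit Arguments.
Unset Strict Implicit.
Unset Printing Implicit Defensive.

Import Order.TTheory GRing.Theory Num.Theory.

Local Open Scope ring_scope.

(** A simple undirected graph on [V] is a symmetric irreflexive [e : rel V]. *)

Definition connected_graph (V : finType) (e : rel V) : Prop :=
  forall x y : V, connect e x y.

Definition degree (V : finType) (e : rel V) (v : V) : nat :=
  #|[set u | e v u]|.

Definition avg_degree (R : realFieldType) (V : finType) (e : rel V) : R :=
  (\sum_(v : V) (degree e v)%:R) / #|V|%:R.

(** A labelling maps a node to [true] iff the node is private. *)
Definition labelling (V : finType) := {ffun V -> bool}.

Definition public (V : finType) (L : labelling V) : {set V} :=
  [set v | ~~ L v].

Definition label_prob (R : realFieldType) (V : finType) (p : R)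
    (L : labelling V) : R :=
  \prod_(v : V) (if L v then p else 1 - p).

Definition E_pri (R : realFieldType) (V : finType) (p : R)
    (X : labelling V -> R) : R :=
  \sum_(L : {ffun V -> bool}) label_prob p L * X L.

Definition Pr_pri (R : realFieldType) (V : finType) (p : R)
    (A : pred (labelling V)) : R :=
  E_pri p (fun L => (A L)%:R).

Definition public_edge (V : finType) (e : rel V) (L : labelling V) : rel V :=
  [rel x y | [&& x \in public L, y \in public L & e x y]].

(** Vertex sets of the connected components of the subgraph induced by the
    public nodes. *)
Definition public_clusters (V : finType) (e : rel V) (L : labelling V) :
    {set {set V}} :=
  [set [set y in public L | connect (public_edge e L) x y] | x in public L].

(** Ties are allowed; without public nodes there is no cluster, and the empty
    set stands for the largest one. *)
Definition is_largest_cluster (V : finType) (e : rel V) (L : labelling V)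
    (C : {set V}) : Prop :=
  (public_clusters e L = set0 /\ C = set0) \/
  (C \in public_clusters e L /\
   forall C' : {set V}, C' \in public_clusters e L -> (#|C'| <= #|C|)%N).

Definition all_public_in_largest (V : finType) (e : rel V) (L : labelling V) :
    Prop :=
  exists2 C : {set V}, is_largest_cluster e L C & public L \subset C.

(** [Vs] gives the vertex set V* of the largest public-cluster for the
    probabilistic analysis made under the condition that all the public nodes
    belong to it. The labels keep their independent law (they are not
    conditioned on the event [all_public_in_largest]); on that event V* is the
    largest public-cluster, and throughout a node is taken to lie in V* with
    the probability that it is public. Asking in addition that V* be the largest
    public-cluster for every labelling would, when 0 < p < 1, leave only the
    complete graphs; as stated, every graph admits such a
    [Vs] (lemma [largest_cluster_model_public]). *)
Definition largest_cluster_model (R : realFieldType) (V : finType) (e : rel V)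
    (p : R) (Vs : labelling V -> {set V}) : Prop :=
  [/\ forall L, all_public_in_largest e L -> is_largest_cluster e L (Vs L),
      forall L, Vs L \subset public L
    & forall v, Pr_pri p (fun L => v \in Vs L)
                = Pr_pri p (fun L => v \in public L)].

(** Public-degree inside the cluster [C]; the edges of a cluster are all the
    edges of the graph between its nodes. *)
Definition public_degree (V : finType) (e : rel V) (C : {set V}) (v : V) : nat :=
  #|[set u in C | e v u]|.

Definition total_public_degree (V : finType) (e : rel V) (C : {set V}) : nat :=
  (\sum_(v in C) public_degree e C v)%N.

Lemma largest_cluster_public (V : finType) (e : rel V) (L : labelling V)
    (C : {set V}) : is_largest_cluster e L C -> C \subset public L.
Proof.
case=> [[_ ->]|[/imsetP[x _ ->] _]]; first exact: sub0set.
by apply/subsetP=> y; rewrite inE => /andP[].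
Qed.

Lemma all_public_in_largestP (V : finType) (e : rel V) (L : labelling V) :
  all_public_in_largest e L -> is_largest_cluster e L (public L).
Proof.
case=> C largeC sPC; suff <- : C = public L by [].
by apply/eqP; rewrite eqEsubset sPC andbT; apply: largest_cluster_public largeC.
Qed.

Lemma largest_cluster_model_public (R : realFieldType) (V : finType)
    (e : rel V) (p : R) : largest_cluster_model e p (@public V).
Proof. by split=> // L; apply: all_public_in_largestP. Qed.

(* Main.v *)
Require Import Defs.
From mathcomp Require Import all_boot all_order all_algebra.

Import Order.TTheory GRing.Theory Num.Theory.

Local Open Scope ring_scope.

(** Since [V*] consists of public nodes and has the same one-point marginals as
    the set of public nodes, the two coincide almost surely. The two ends of an
    edge are both public with probability [(1 - p)^2], so [E D* ] is
    [(1 - p)^2 * \sum_v d_v] while the sum of the [d*_v / d_v] has expectation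
    [(1 - p)^2 * n]. Hence the left-hand side vanishes, except when [E D* = 0],
    in which case both sides are equal to the average degree. *)

Lemma label_prob_ge0 {R : realFieldType} {V : finType} {p : R}
    (p_ge0 : 0 <= p) (p_le1 : p <= 1) (L : labelling V) : 0 <= label_prob p L.
Proof. by apply: prodr_ge0 => v _; case: (L v); rewrite ?subr_ge0. Qed.

(** By independence: the indicator splits into one factor per node, so the sum over labellings of a
    product becomes a product over nodes of two-term sums. Such a sum is [1 - p] on [A] and
    [p + (1 - p) = 1] off [A]. *)
Lemma Pr_sub_public {R : realFieldType} {V : finType} (p : R) (A : {set V}) :
  Pr_pri p (fun L => A \subset public L) = (1 - p) ^+ #|A|.
Proof.
rewrite /Pr_pri /E_pri.
pose F (v : V) (b : bool) : R :=
  (if b then p else 1 - p) * ((v \in A) ==> ~~ b)%:R.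
transitivity (\sum_(L : {ffun V -> bool}) \prod_v F v (L v)).
  apply: eq_bigr => L _; rewrite /label_prob big_split /=; congr (_ * _).
  have [sAL|/subsetPn[v vA vL]] := boolP (A \subset public L).
    rewrite big1 // => v _; case vA: (v \in A) => //=.
    by have := subsetP sAL v vA; rewrite inE => ->.
  by rewrite (bigD1 v) //= vA /= [~~ L v](_ : _ = false) ?mul0r //;
     move: vL; rewrite inE => /negbTE.
rewrite -(bigA_distr_bigA F) -prodr_const [RHS]big_mkcond /=.
apply: eq_bigr => v _.
rewrite big_bool /F; case: (v \in A) => /=; first by rewrite mulr0 add0r mulr1.
by rewrite !mulr1 addrC subrK.
Qed.

Section LargestClusterModel.

Context {R : realFieldType} {V : finType} {e : rel V} {p : R}.
Context {Vs : labelling V -> {set V}}.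
Hypotheses (p_ge0 : 0 <= p) (p_le1 : p <= 1).
Hypothesis Vs_model : largest_cluster_model e p Vs.

Lemma largest_cluster_model_as (L : labelling V) :
  label_prob p L = 0 \/ Vs L = public L.
Proof.
have [_ sVs prVs] := Vs_model.
have [->|prL] := eqVneq (label_prob p L) 0; [by left | right].
apply/eqP; rewrite eqEsubset sVs /=; apply/subsetP => v vL.
(* Equal marginals at [v] make these terms sum to zero, while [Vs M] being inside [public M] makes
   each nonnegative; so each one vanishes, in particular at [L], where the probability is
   nonzero. *)
pose D (M : labelling V) : R :=
  label_prob p M * ((v \in public M)%:R - (v \in Vs M)%:R).
have D_ge0 M : true -> 0 <= D M.
  move=> _; apply: mulr_ge0; first exact: label_prob_ge0.
  rewrite subr_ge0 ler_nat; case vM: (v \in Vs M) => //.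
  by rewrite (subsetP (sVs M) v vM).
have D_sum0 : \sum_(M : {ffun V -> bool}) D M = 0.
  rewrite (eq_bigr _ (fun M _ => mulrBr _ _ _)) sumrB.
  by apply/eqP; rewrite subr_eq0; apply/eqP/esym/prVs.
have /eqP : D L = 0 by apply: (psumr_eq0P D_ge0 D_sum0).
rewrite /D mulf_eq0 (negbTE prL) /= vL; case: (v \in Vs L) => //.
by rewrite subr0 oner_eq0.
Qed.

Lemma E_pri_largest_cluster (X : {set V} -> R) :
  E_pri p (fun L => X (Vs L)) = E_pri p (fun L => X (public L)).
Proof.
apply: eq_bigr => L _.
by have [->|->] := largest_cluster_model_as L; rewrite ?mul0r.
Qed.

End LargestClusterModel.

(** Linearity of expectation over ordered adjacent pairs. The weight [w] lets one computation serve
    both expectations: [w = 1] for the total public-degree, [w v = 1 / d_v] for the sum of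
    ratios. *)
Lemma E_pri_weighted_degree {R : realFieldType} {V : finType} {e : rel V}
    (e_irr : irreflexive e) (p : R) (w : V -> R) :
  E_pri p (fun L => \sum_(v in public L)
                      (public_degree e (public L) v)%:R * w v)
  = (1 - p) ^+ 2 * \sum_v (degree e v)%:R * w v.
Proof.
transitivity (E_pri p (fun L => \sum_v \sum_(u | e v u)
    ([set v; u] \subset public L)%:R * w v)).
  apply: eq_bigr => L _; congr (_ * _); rewrite big_mkcond /=.
  apply: eq_bigr => v _; rewrite -mulr_suml.
  under eq_bigr => u _ do rewrite subUset !sub1set.
  case: (v \in public L) => /=; last by rewrite big1 ?mul0r.
  rewrite /public_degree -sum1_card natr_sum big_mkcond [in RHS]big_mkcond /=.
  congr (_ * _); apply: eq_bigr => u _; rewrite inE.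
  by case: (u \in _); case: (e v u).
rewrite /E_pri; under eq_bigr => L _ do rewrite mulr_sumr.
rewrite exchange_big /= mulr_sumr; apply: eq_bigr => v _.
under eq_bigr => L _ do rewrite mulr_sumr.
rewrite exchange_big /= mulrA [_ * (degree e v)%:R]mulrC.
rewrite /degree -sum1_card natr_sum !mulr_suml.
rewrite [RHS](eq_bigl (e v)) => [|u]; last by rewrite inE.
apply: eq_bigr => u evu; under eq_bigr => L _ do rewrite mulrA.
rewrite -mulr_suml mul1r; congr (_ * _).
(* A loop would make the pair a singleton and the exponent 1 instead of 2. *)
have neq_vu : v != u by apply: contraTneq evu => ->; rewrite e_irr.
by have := Pr_sub_public p [set v; u]; rewrite cards2 neq_vu.
Qed.

(** The first step of a path from [v] to [w] provides a neighbour of [v]. *)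
Lemma degree_gt0 {V : finType} {e : rel V} (e_conn : connected_graph e)
    (v w : V) : v != w -> (0 < degree e v)%N.
Proof.
have /connectP[[|u s] /= es ->] := e_conn v w; first by rewrite eqxx.
by case/andP: es => evu _ _; apply/card_gt0P; exists u; rewrite inE.
Qed.

Theorem corollary4p13 (R : realFieldType) (V : finType) (e : rel V)
    (e_sym : symmetric e) (e_irr : irreflexive e)
    (V_gt0 : (0 < #|V|)%N) (e_conn : connected_graph e)
    (p : R) (p_ge0 : 0 <= p) (p_le1 : p <= 1)
    (Vs : labelling V -> {set V}) (Vs_model : largest_cluster_model e p Vs) :
  `| avg_degree R e
     - E_pri p (fun L => (total_public_degree e (Vs L))%:R)
       / E_pri p (fun L => \sum_(v in Vs L)
                             (public_degree e (Vs L) v)%:R / (degree e v)%:R) |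
  <= `| avg_degree R e
        - E_pri p (fun L => (total_public_degree e (Vs L))%:R)
          / E_pri p (fun L => #|Vs L|%:R) |.
Proof.
have ED : E_pri p (fun L => (total_public_degree e (Vs L))%:R)
    = (1 - p) ^+ 2 * \sum_v (degree e v)%:R :> R.
  rewrite (E_pri_largest_cluster p_ge0 p_le1 Vs_model
    (fun C => (total_public_degree e C)%:R)).
  rewrite -(eq_bigr _ (fun v _ => mulr1 _)) -E_pri_weighted_degree //.
  apply: eq_bigr => L _; congr (_ * _); rewrite natr_sum.
  by apply: eq_bigr => v _; rewrite mulr1.
(* The zero case is [p = 1] or a one-node graph: both quotients are then 0, whatever their
   denominators. *)
have [ED0|] := eqVneq (E_pri p (fun L => (total_public_degree e (Vs L))%:R)) 0.
  by rewrite ED0 !mul0r.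
rewrite ED mulf_eq0 negb_or => /andP[q_neq0 S_neq0].
rewrite (E_pri_largest_cluster p_ge0 p_le1 Vs_model (fun C =>
  \sum_(v in C) (public_degree e C v)%:R / (degree e v)%:R)).
rewrite (E_pri_weighted_degree e_irr p (fun v => (degree e v)%:R^-1)).
(* By connectedness a node of degree zero would be the only node, and the degree sum would be
   zero. *)
have deg_gt0 v : (0 < degree e v)%N.
  rewrite lt0n; apply: contraNneq S_neq0 => dv0; apply/eqP/big1 => w _.
  have [->|neq_wv] := eqVneq w v; first by rewrite dv0.
  by rewrite eq_sym in neq_wv; have := degree_gt0 e_conn v w neq_wv; rewrite dv0.
have -> : \sum_v (degree e v)%:R / (degree e v)%:R = #|V|%:R :> R.
  by under eq_bigr => v _ do rewrite divff ?pnatr_eq0 -?lt0n //;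
     rewrite sumr_const.
(* The common factor [(1 - p) ^+ 2] cancels and leaves exactly the average degree. *)
by rewrite -mulf_div divff // mul1r subrr normr0.
Qed.
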